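(* Let $G$ be a finite group with $d(G)=2$. Then $G$ satisfies the rank-independence property if and only if one of the following occurs: (i) $G\cong C_p\times C_p$, with $p$ a prime; (ii) $G\cong Q_8$; or (iii) $G\cong C_p\rtimes C_{q^m}$, where $p$ and $q$ are distinct primes, $m$ is an arbitrary positive integer, and the action of $C_{q^m}$ on $C_p$ has kernel $C_{q^{m-1}}$ (the subgroup of order $q^{m-1}$ of $C_{q^m}$).
   Context: For a finite group $G$, $d(G)$ denotes the smallest cardinality of a generating set for $G$. A non-cyclic finite group $G$ satisfies the rank-independence property if, for all distinct $x,y\in G$ such that $\langle x,y\rangle$ is not cyclic, the set $\{x,y\}$ is contained in a generating set for $G$ of cardinality $d(G)$. $C_n$ is the cyclic group of order $n$ and $Q_8$ is the quaternion group of order $8$. *)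

(* Defs.v *)
From HB Require Import structures.
From mathcomp Require Import all_boot all_order all_algebra.
From mathcomp Require Import all_fingroup all_solvable.

Set Implicit Arguments.
Unset Strict Implicit.
Unset Printing Implicit Defensive.

Import GroupScope.

(* d(G) is the library's generator rank 'm(G). *)
Definition rank_independent (gT : finGroupType) (G : {set gT}) : Prop :=
  ~~ cyclic G /\
  (forall x y : gT, x \in G -> y \in G -> x != y ->
     ~~ cyclic <<[set x; y]>> ->
     exists B : {set gT},
       [/\ <<B>> = G, #|B| = 'm(G), x \in B & y \in B]).

(* C_n is represented by the additive group 'Z_n; this has order n only when
   n > 1, which holds at each use below.  The kernel of the action [to] of
   C_(q^m) on C_p is the pointwise stabiliser of C_p; having order q^(m-1)
   determines it as a subgroup of the cyclic group C_(q^m). *)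
Definition is_Cp_sdprod_Cqm (gT : finGroupType) (G : {set gT}) : Prop :=
  exists p q m : nat,
    [/\ prime p, prime q, p != q & 0 < m] /\
    exists to : groupAction [set: 'Z_(q ^ m)] [set: 'Z_p],
      #|'C([set: 'Z_p] | to)| = (q ^ m.-1)%N /\
      G \isog [set: sdprod_by to].

(* Main.v *)
Require Import Defs.
From mathcomp Require Import all_boot all_order all_algebra.
From mathcomp Require Import all_fingroup all_solvable.
From mathcomp Require Import zify.

Set Implicit Arguments.
Unset Strict Implicit.
Unset Printing Implicit Defensive.

Import GroupScope.

(** When d(G) = 2 the rank-independence property says that two elements
    generating a non-cyclic subgroup generate G.  Since every non-cyclic group
    contains a non-cyclic 2-generated subgroup, this means exactly that G is
    minimal non-cyclic: all its proper subgroups are cyclic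
    ([rank_independentP]).  The theorem is thus the Miller-Moreno
    classification of minimal non-cyclic groups.

    If G is a p-group and Omega_1(G) does not have order p, a central element
    of order p and another element of order p span a copy of C_p x C_p, which
    must be all of G.  If Omega_1(G) has order p, then G, not being cyclic, is
    generalized quaternion, and it has order 8 because a larger quaternion
    group contains a proper quaternion subgroup ([pgroup_proper_cyclic]).

    If G is not of prime power order, a counting argument on the conjugates of
    maximal subgroups gives a normal maximal subgroup M
    ([exists_normal_maximal]).  Let q be a prime dividing |G : M|, S a Sylow
    q-subgroup of G, and H the Hall q'-subgroup of the cyclic group M.  As G is
    not cyclic, [H, S] is nontrivial, and S acts without nontrivial fixed
    points on it; a subgroup P of prime order p of [H, S] is normal in G and
    not centralised by S, so PS is not cyclic and G = PS.  The maximal subgroup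
    T of S satisfies PT < G, so T centralises P and T = C_S(P)
    ([nonpgroup_proper_cyclic]).

    Conversely, for the groups PS a proper subgroup either avoids P, and then
    embeds in G / P, or contains P, and then is the direct product of P with a
    proper subgroup of S ([Cp_sdprod_Cqm_proper_cyclic]). *)

(** * Rank independence and minimal non-cyclic groups *)

Definition proper_cyclic {gT : finGroupType} (G : {set gT}) : Prop :=
  forall H : {group gT}, H \proper G -> cyclic H.

Lemma isog_proper_cyclic (aT rT : finGroupType) (G : {group aT})
    (K : {group rT}) :
  G \isog K -> proper_cyclic K -> proper_cyclic G.
Proof.
case/isogP=> f injf defK prK H prHG.
have sHG := proper_sub prHG.
rewrite -(injm_cyclic injf sHG); apply: prK.
by rewrite -defK injm_proper.
Qed.

Lemma grank2_noncyclic (gT : finGroupType) (G : {group gT}) :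
  'm(G) = 2 -> ~~ cyclic G.
Proof.
move=> dG; apply/negP=> /cyclicP[a defG].
by have := grank_min [set a]; rewrite cards1 -/(cycle a) -defG dG.
Qed.

(** A maximal cyclic subgroup <[x]> of H is not H, and adding to x any y
    outside of <[x]> generates a subgroup that is too large to be cyclic. *)
Lemma noncyclic_two_gen (gT : finGroupType) (H : {group gT}) :
  ~~ cyclic H ->
  exists x y, [/\ x \in H, y \in H, x != y & ~~ cyclic <<[set x; y]>>].
Proof.
move=> ncH.
case: (@arg_maxnP _ 1 (fun x => x \in H) order (group1 H)) => x Hx max_x.
have /subsetPn[y Hy x'y]: ~~ (H \subset <[x]>).
  by apply: contra ncH => /cyclicS->//; apply: cycle_cyclic.
exists x, y; split=> //.
  by apply: contraNneq x'y => <-; apply: cycle_id.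
apply/negP=> /cyclicP[c defc].
have /subsetP sxyc: [set x; y] \subset <[c]> by rewrite -defc subset_gen.
have cx: x \in <[c]> by rewrite sxyc ?set21.
have cy: y \in <[c]> by rewrite sxyc ?set22.
have Hc: c \in H.
  by rewrite -cycle_subG -defc gen_subG subUset !sub1set Hx.
have defx: <[x]> = <[c]>.
  by apply/eqP; rewrite eqEcard cycle_subG cx; apply: max_x.
by rewrite defx cy in x'y.
Qed.

(** A generating set of cardinality 2 that contains x != y is {x, y}. *)
Lemma rank_independentP (gT : finGroupType) (G : {group gT}) :
  'm(G) = 2 -> rank_independent G <-> proper_cyclic G.
Proof.
move=> dG; split=> [[_ indG] H prHG | prG].
  have [// | /noncyclic_two_gen[x [y [Hx Hy neq_xy ncxy]]]] := boolP (cyclic H).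
  have /subsetP sHG := proper_sub prHG.
  have [B [defG]] := indG x y (sHG x Hx) (sHG y Hy) neq_xy ncxy.
  rewrite dG => oB Bx By.
  have defB: [set x; y] = B.
    by apply/eqP; rewrite eqEcard oB cards2 neq_xy subUset !sub1set Bx By.
  case/andP: prHG => _ /negP[].
  by rewrite -defG -defB gen_subG subUset !sub1set Hx Hy.
split=> [|x y Gx Gy neq_xy ncxy]; first exact: grank2_noncyclic.
exists [set x; y]; split; rewrite ?set21 ?set22 ?dG ?cards2 ?neq_xy //.
have sG: <<[set x; y]>> \subset G by rewrite gen_subG subUset !sub1set Gx Gy.
apply/eqP; move: sG; rewrite subEproper => /predU1P[-> // | /prG cyc].
by rewrite cyc in ncxy.
Qed.

(** * Groups of prime power order *)

Lemma prime_square_proper_cyclic (gT : finGroupType) (G : {group gT}) (p : nat) :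
  prime p -> #|G| = (p ^ 2)%N -> proper_cyclic G.
Proof.
move=> p_pr oG H prHG.
have := cardSg (proper_sub prHG); rewrite oG => /dvdn_pfactor[//|k le_k2 oH].
have := proper_card prHG; rewrite oH oG ltn_exp2l ?prime_gt1 //.
case: k oH {le_k2} => [|[|//]] oH _; last by apply: prime_cyclic; rewrite oH.
by rewrite (card1_trivg oH) cyclic1.
Qed.

Lemma ZpZp_abelem p :
  prime p -> p.-abelem [set: 'Z_p * 'Z_p] /\ #|[set: 'Z_p * 'Z_p]| = (p ^ 2)%N.
Proof.
move=> p_pr; have p_gt1 := prime_gt1 p_pr; split; last first.
  by rewrite cardsT card_prod card_ord Zp_cast.
have abelZp (A : {group 'Z_p}) : p.-abelem A.
  by apply: (abelemS (subsetT A)); rewrite prime_abelem // cardsT card_ord Zp_cast.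
have -> : [set: 'Z_p * 'Z_p] = setX setT setT by apply/setP=> u; rewrite !inE.
rewrite (dprod_abelem p (setX_dprod [set: 'Z_p]%G [set: 'Z_p]%G)).
rewrite -morphim_pairg1 -morphim_pair1g.
by rewrite !morphim_abelem.
Qed.

Lemma quaternion_nonabelian (gT : finGroupType) (G : {group gT}) n :
  2 < n -> G \isog 'Q_(2 ^ n) -> ~~ abelian G.
Proof.
move=> n_gt2 isoG; have [[x y] genG _] := generators_quaternion n_gt2 isoG.
have [_ [_ _ oG' _] _ _ _] := quaternion_structure n_gt2 genG isoG.
rewrite (sameP derG1P eqP) trivg_card1 oG' -(expn0 2) eqn_exp2l //.
by rewrite -(subnKC n_gt2).
Qed.

(** A proper subgroup H inherits the unique involution of G, so it is cyclic or
    generalized quaternion; the order of H rules out the latter. *)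
Lemma Q8_proper_cyclic (gT : finGroupType) (G : {group gT}) :
  G \isog 'Q_8 -> proper_cyclic G.
Proof.
move=> isoG H prHG.
have [-> | ntH] := eqVneq H 1%G; first exact: cyclic1.
have oG: #|G| = 8 by rewrite (card_isog isoG) (@card_quaternion 3).
have pG: 2.-group G by rewrite /pgroup oG.
have sHG := proper_sub prHG; have pH := pgroupS sHG pG.
have ntG: G :!=: 1 by rewrite -cardG_gt1 oG.
have oG1: #|'Ohm_1(G)| = 2.
  apply/(prime_Ohm1P pG ntG)/orP; right; apply/eqP/quaternion_classP.
  by exists 3.
have oH1: #|'Ohm_1(H)| = 2.
  apply/eqP; rewrite eqn_leq -{1}oG1 subset_leq_card ?OhmS //=.
  by rewrite cardG_gt1 Ohm1_eq1.
case/(prime_Ohm1P pH ntH)/orP: oH1 => // /andP[_ /eqP/quaternion_classP[n n_gt2 isoH]].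
have := proper_card prHG; rewrite oG (card_isog isoH) card_quaternion //.
by rewrite (@ltn_exp2l 2 n 3) // ltnNge n_gt2.
Qed.

(** E is generated by a central element z of order p and an element x of order
    p outside of <[z]>, which exists because otherwise Omega_1(G) = <[z]>. *)
Lemma noncyclic_Ohm1_abelem2 (gT : finGroupType) (G : {group gT}) (p : nat) :
    p.-group G -> G :!=: 1 -> #|'Ohm_1(G)| != p ->
  exists E : {group gT},
    [/\ E \subset G, ~~ cyclic E, p.-abelem E & #|E| = (p ^ 2)%N].
Proof.
move=> pG ntG oG1; have [p_pr _ _] := pgroup_pdiv pG ntG.
have ntZ: 'Z(G) != 1 by rewrite center_nil_eq1 ?(pgroup_nil pG).
have [_ pZ _] := pgroup_pdiv (pgroupS (center_sub G) pG) ntZ.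
have [z Zz oz] := Cauchy p_pr pZ.
have [Gz cGz] := centerP _ _ Zz.
have oZ: prime #|<[z]>| by rewrite -orderE oz.
have /subsetPn[x]: ~~ ('Ldiv_p(G) \subset <[z]>).
  apply: contra oG1 => sLz.
  have sGz: 'Ohm_1(G) \subset <[z]> by rewrite (OhmE 1 pG) expn1 gen_subG.
  rewrite eqn_leq -{1}oz subset_leq_card //= -oz subset_leq_card // cycle_subG.
  by rewrite /= (OhmE 1 pG) mem_gen // !inE Gz /= expn1 -order_dvdn oz.
rewrite !inE => /andP[Gx xp1] z'x.
have ox: #[x] = p.
  apply: nt_prime_order => //; first exact/eqP.
  by apply: contraNneq z'x => ->; apply: group1.
have cxz: <[x]> \subset 'C(<[z]>).
  by rewrite cycle_subG /= cent_cycle; apply/cent1P; have := cGz x Gx; rewrite /commute.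
have tiZX: <[z]> :&: <[x]> = 1.
  rewrite setIC; apply: prime_TIg; first by rewrite -orderE ox.
  by rewrite cycle_subG.
have defE: <[z]> \x <[x]> = <[z]> <*> <[x]>.
  by rewrite dprodEY.
have oE: #|<[z]> <*> <[x]>| = (p ^ 2)%N.
  by rewrite -(dprod_card defE) -!orderE oz ox.
exists (<[z]> <*> <[x]>)%G; split=> //.
- by rewrite join_subG !cycle_subG Gz.
- rewrite (cyclic_dprod defE) ?cycle_cyclic // -!orderE oz ox.
  by rewrite prime_coprime // dvdnn.
by rewrite (dprod_abelem p defE) !prime_abelem // -?orderE.
Qed.

(** A p-group whose Omega_1 has order p is cyclic or generalized quaternion;
    the maximal subgroups of 'Q_(2 ^ n) other than the cyclic one are copies of
    'Q_(2 ^ n.-1), which are not cyclic when n > 3. *)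
Lemma pgroup_proper_cyclic (gT : finGroupType) (G : {group gT}) (p : nat) :
    p.-group G -> ~~ cyclic G -> proper_cyclic G ->
  (prime p /\ G \isog [set: 'Z_p * 'Z_p]) \/ G \isog 'Q_8.
Proof.
move=> pG ncG prG.
have ntG: G :!=: 1 by apply: contraNneq ncG => ->; apply: cyclic1.
have [p_pr _ _] := pgroup_pdiv pG ntG.
have [oG1 | oG1] := eqVneq #|'Ohm_1(G)| p; last first.
  left; split=> //.
  have [E [sEG ncE abelE oE]] := noncyclic_Ohm1_abelem2 pG ntG oG1.
  have defG: E :=: G.
    move: sEG; rewrite subEproper => /predU1P[// | /prG cycE].
    by rewrite cycE in ncE.
  rewrite -defG; have [abelZ oZ] := ZpZp_abelem p_pr.
  by rewrite (isog_abelem_card _ abelE) abelZ oZ oE /=.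
right; move: oG1 => /(prime_Ohm1P pG ntG); rewrite (negPf ncG) /=.
case/andP=> _ /eqP/quaternion_classP[n n_gt2 isoG].
have [n_gt3 | n_le3] := ltnP 3 n; last first.
  by have n3: n = 3 by [apply/eqP; rewrite eqn_leq n_le3]; rewrite n3 in isoG.
have [[x y] genG _] := generators_quaternion n_gt2 isoG.
have [_ _ _ _ /(_ n_gt3)[isoM _ _]] := quaternion_structure n_gt2 genG isoG.
have n1_gt2: 2 < n.-1 by rewrite -ltnS (ltn_predK n_gt2).
have /negP[] := quaternion_nonabelian n1_gt2 isoM.
have Gy: y \in G by have [_ _ _ /setDP[]] := genG.
apply/cyclic_abelian/prG; rewrite properEcard gen_subG class_subG //=.
rewrite (card_isog isoM) (card_isog isoG) !card_quaternion //.
by rewrite ltn_exp2l // (ltn_predK n_gt2).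
Qed.

(** * A normal maximal subgroup *)

(** Suppose that no maximal subgroup is normal, and let Z be the center of G.
    Distinct maximal subgroups are abelian and generate G, so they meet inside
    Z; each is its own normalizer, hence contains Z.  So the conjugates of
    M :\: Z are disjoint and cover |G| - |Z| |G : M| elements of G :\: Z.  This
    is at least |G| / 2, because 2 |Z| <= |M|, but less than |G| - |Z|.  An
    element of G :\: Z that is not covered lies in another maximal subgroup K,
    whose conjugates cover at least |G| / 2 further elements of G :\: Z, and
    there is not enough room for both. *)
Lemma exists_normal_maximal (gT : finGroupType) (G : {group gT}) :
    G :!=: 1 -> (forall H : {group gT}, H \proper G -> abelian H) ->
  exists2 M : {group gT}, maximal M G & M <| G.
Proof.
move=> ntG prG.
suffices /existsP[M /andP[]]: [exists M : {group gT}, maximal M G && (M <| G)].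
  by exists M.
have [// | /existsPn no_nmax] :=
  boolP [exists M : {group gT}, maximal M G && (M <| G)].
have nmax (M : {group gT}) : maximal M G -> ~~ (M <| G).
  by move=> maxM; have := no_nmax M; rewrite maxM.
have prM (M : {group gT}) : maximal M G -> M \proper G by case/maxgroupP.
have sMG (M : {group gT}) maxM := proper_sub (prM M maxM).
have maxE (M H : {group gT}) : maximal M G -> M \subset H -> H \proper G -> H :=: M.
  by case/maxgroupP=> _ max sMH prH; apply: max.
have normM (M : {group gT}) : maximal M G -> 'N_G(M) = M.
  move=> maxM; apply: (maxE M 'N_G(M)%G) => //.
    by rewrite subsetI sMG ?normG.
  rewrite properEneq subsetIl andbT; apply: contra (nmax M maxM) => /eqP defN.
  by rewrite /normal sMG // -defN subsetIr.
pose Z := 'Z(G)%G.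
have sZM (M : {group gT}) : maximal M G -> Z \subset M.
  move=> maxM; rewrite -(normM M maxM) subsetI center_sub.
  by rewrite cents_norm // centsC (subset_trans (sMG M maxM)) // centsC subsetIr.
have meetZ (M K : {group gT}) : maximal M G -> maximal K G -> M :!=: K ->
  M :&: K \subset Z.
  move=> maxM maxK neqMK; rewrite subsetI subIset ?sMG //=.
  have defG: M <*> K = G.
    have: M <*> K \subset G by rewrite join_subG !sMG.
    rewrite subEproper => /predU1P[// | prMK].
    case/eqP: neqMK; apply: (maxE K M) => //; last exact: prM.
    by rewrite -(maxE M (M <*> K)%G maxM (joing_subl _ _) prMK) joing_subr.
  have := prG M (prM M maxM); have := prG K (prM K maxK); rewrite /abelian => cKK cMM.
  by rewrite -defG centY subsetI !subIset ?cKK ?cMM ?orbT.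
have tiM (M : {group gT}) : maximal M G -> normedTI (M :\: Z) G M.
  move=> maxM; apply/normedTI_memJ_P; split; rewrite ?sMG //.
    apply: contra (nmax M maxM); rewrite setD_eq0 => sMZ.
    by rewrite sub_center_normal.
  move=> a g /setDP[Ma Z'a] Gg; rewrite inE.
  have nZg: g \in 'N(Z) by rewrite (subsetP (normal_norm (center_normal G))).
  rewrite memJ_norm // Z'a /=; apply/idP/idP=> [Mag | Mg]; last by rewrite groupJ.
  rewrite -(normM M maxM) inE Gg; apply/normP; apply: contraNeq Z'a => neqM.
  rewrite -(memJ_norm a nZg); apply: subsetP (meetZ (M :^ g)%G M _ maxM neqM) _ _.
    by rewrite -(conjGid Gg) maximalJ.
  by rewrite inE memJ_conjg Ma.
have idx (M : {group gT}) : maximal M G -> 1 < #|G : M|.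
  by move=> maxM; rewrite indexg_gt1 proper_subn ?prM.
have oCS (M : {group gT}) : maximal M G ->
  #|class_support (M :\: Z) G| = ((#|M| - #|Z|) * #|G : M|)%N.
  move=> maxM; rewrite (card_support_normedTI (tiM M maxM)).
  by rewrite cardsD (setIidPr (sZM M maxM)).
have half (M : {group gT}) : maximal M G ->
  #|G| <= 2 * #|class_support (M :\: Z) G|.
  move=> maxM; rewrite oCS // mulnA -(Lagrange (sMG M maxM)) leq_mul2r.
  apply/orP; right; have oM := Lagrange (sZM M maxM).
  have: 1 < #|M : Z|.
    rewrite indexg_gt1; apply: contra (nmax M maxM) => sMZ.
    by rewrite sub_center_normal.
  rewrite -oM; nia.
have sCS (M : {group gT}) : maximal M G -> class_support (M :\: Z) G \subset G :\: Z.
  move=> maxM; apply/subsetP=> _ /imset2P[a g /setDP[Ma Z'a] Gg ->].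
  have nZg: g \in 'N(Z) by rewrite (subsetP (normal_norm (center_normal G))).
  by rewrite inE memJ_norm // Z'a groupJ // (subsetP (sMG M maxM)).
have oGZ: #|G :\: Z| = (#|G| - #|Z|)%N.
  by rewrite cardsD (setIidPr (center_sub G)).
have [G1 | [M maxM _]] := maximal_exists (sub1G G); first by rewrite -G1 eqxx in ntG.
have /subsetPn[x GZx CS'x]: ~~ (G :\: Z \subset class_support (M :\: Z) G).
  apply/negP=> /subset_leq_card; rewrite oCS // oGZ.
  have := subset_leq_card (sZM M maxM); have := cardG_gt0 Z.
  have := Lagrange (sMG M maxM); have := idx M maxM.
  nia.
have [Gx Z'x] := setDP GZx.
have sxG: <[x]> \subset G by rewrite cycle_subG.
have [defG | [K maxK Kx]] := maximal_exists sxG.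
  have cGG: abelian G by rewrite -defG cycle_abelian.
  by case/negP: Z'x; rewrite inE Gx (subsetP cGG).
rewrite cycle_subG in Kx.
have tiCS: [disjoint class_support (M :\: Z) G & class_support (K :\: Z) G].
  apply/pred0P=> y /=; apply/negP=> /andP[CMy].
  case/imset2P=> b h /setDP[Kb Z'b] Gh defy; subst y.
  case/imset2P: CMy => a g /setDP[Ma Z'a] Gg def_y.
  have nZh: h \in 'N(Z) by rewrite (subsetP (normal_norm (center_normal G))).
  have [eqMK | neqMK] := eqVneq (M :^ g) (K :^ h).
    case/negP: CS'x; rewrite class_supportEr.
    apply/bigcupP; exists (g * h^-1); first by rewrite groupM ?groupV.
    have nZ: g * h^-1 \in 'N(Z).
      by rewrite (subsetP (normal_norm (center_normal G))) // groupM ?groupV.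
    by rewrite conjDg (normP nZ) inE Z'x conjsgM eqMK conjsgK.
  case/negP: Z'b; rewrite -(memJ_norm b nZh).
  apply: subsetP (meetZ (M :^ g)%G (K :^ h)%G _ _ neqMK) _ _.
  - by rewrite -(conjGid Gg) maximalJ.
  - by rewrite -(conjGid Gh) maximalJ.
  by rewrite inE {1}def_y !memJ_conjg Ma Kb.
have := subset_leq_card (sCS M maxM).
have: class_support (M :\: Z) G :|: class_support (K :\: Z) G \subset G :\: Z.
  by rewrite subUset !sCS.
move/subset_leq_card; rewrite cardsU (disjoint_setI0 tiCS) cards0 subn0 oGZ.
have := half M maxM; have := half K maxK; have := cardG_gt0 Z; have := cardG_gt0 G.
lia.
Qed.

(** * The semidirect products of C_p by C_(q^m) *)

(** An internal counterpart of [is_Cp_sdprod_Cqm]: here 'C_S(P) is the kernel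
    of the action, so no action has to be carried along. *)
Definition Cp_sdprod_Cqm_in (gT : finGroupType) (G P S : {group gT})
    (p q m : nat) : Prop :=
  [/\ prime p, prime q, p != q & 0 < m] /\
  [/\ P ><| S = G, #|P| = p, cyclic S, #|S| = (q ^ m)%N
    & #|'C_S(P)| = (q ^ m.-1)%N].

(** If P is not contained in H, then H embeds in the quotient G / P, which is
    isomorphic to S.  Otherwise H = P * (S :&: H), where S :&: H, being proper
    in the cyclic q-group S, lies in its subgroup of index q, namely 'C_S(P). *)
Lemma Cp_sdprod_Cqm_proper_cyclic (gT : finGroupType) (G P S : {group gT})
    (p q m : nat) :
  Cp_sdprod_Cqm_in G P S p q m -> proper_cyclic G.
Proof.
case=> -[p_pr q_pr neq_pq m_gt0] [defG oP cycS oS oC] H prHG.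
have sHG := proper_sub prHG.
have [_ defPS nPS tiPS] := sdprodP defG.
have [nsPG sSG _ _ _] := sdprod_context defG.
have nPH: H \subset 'N(P) := subset_trans sHG (normal_norm nsPG).
have prP: prime #|P| by rewrite oP.
have [sPH | tiPH] := prime_subgroupVti H prP; last first.
  rewrite setIC in tiPH; rewrite (isog_cyclic (quotient_isog nPH tiPH)).
  apply: cyclicS (quotientS P sHG) _.
  by rewrite -(isog_cyclic (sdprod_isog defG)).
have defH: P * (S :&: H) = H.
  by rewrite group_modl // defPS; apply/setIidPr.
have sKC: S :&: H \subset 'C_S(P).
  rewrite -(cardSg_cyclic cycS) ?subsetIl // oC.
  have: #|S :&: H| %| q ^ m by rewrite -oS cardSg ?subsetIl.
  case/(dvdn_pfactor _ _ q_pr)=> k le_km oK.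
  rewrite oK dvdn_exp2l // -ltnS prednK // ltn_neqAle le_km andbT.
  apply: contraL prHG => /eqP eq_km; rewrite properE sHG negbK -defPS mul_subG //.
  rewrite (_ : S :=: S :&: H) ?subsetIr //; apply/esym/eqP.
  by rewrite eqEcard subsetIl oK eq_km oS /=.
rewrite -defH; apply: cyclicM.
- exact: prime_cyclic.
- by apply: cyclicS cycS; apply: subsetIl.
- exact: subset_trans sKC (subsetIr _ _).
apply: coprimegS (subsetIl S H) _; rewrite oP oS coprimeXr //.
by rewrite prime_coprime // dvdn_prime2.
Qed.

Lemma cyclic_Zp n : cyclic [set: 'Z_n].
Proof. by apply/cyclicP; exists Zp1; apply: Zp_cycle. Qed.

Lemma sdprod_by_Cp_sdprod_Cqm_in (p q m : nat)
    (to : groupAction [set: 'Z_(q ^ m)] [set: 'Z_p]) :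
    [/\ prime p, prime q, p != q & 0 < m] ->
    #|'C([set: 'Z_p] | to)| = (q ^ m.-1)%N ->
  Cp_sdprod_Cqm_in [set: sdprod_by to]%G
    (sdpair1 to @* [set: 'Z_p])%G (sdpair2 to @* [set: 'Z_(q ^ m)])%G p q m.
Proof.
move=> pqm oC; split=> //; have [p_pr q_pr _ m_gt0] := pqm.
have qm_gt1: 1 < q ^ m by rewrite -(exp1n m) ltn_exp2r ?prime_gt1.
split.
- exact: sdprod_sdpair.
- by rewrite (card_injm (injm_sdpair1 to)) // cardsT card_ord Zp_cast ?prime_gt1.
- exact: morphim_cyclic (cyclic_Zp _).
- by rewrite (card_injm (injm_sdpair2 to)) // cardsT card_ord Zp_cast.
rewrite -oC astabEsd //= -morphim_setIpre setTI (card_injm (injm_sdpair2 to)) //.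
exact: subsetT.
Qed.

(** Conjugation by S on P is transported to an action of aT on rT along
    isomorphisms f and g; its stabiliser of rT corresponds to 'C_S(P) under g. *)
Lemma sdprod_isog_sdprod_by (gT aT rT : finGroupType) (G P S : {group gT}) :
    P ><| S = G -> [set: rT] \isog P -> [set: aT] \isog S ->
  exists to : groupAction [set: aT] [set: rT],
    #|'C([set: rT] | to)| = #|'C_S(P)| /\ G \isog [set: sdprod_by to].
Proof.
move=> defG /isogP[f injf imf] /isogP[g injg img].
have [_ defPS nPS tiPS] := sdprodP defG.
have Pf x : f x \in P by rewrite -imf mem_morphim ?inE.
have Sg a : g a \in S by rewrite -img mem_morphim ?inE.
have fI x y : f x = f y -> x = y by apply: (injmP injf); rewrite inE.
pose conj x a := invm injf (f x ^ g a).
have conjE x a : f (conj x a) = f x ^ g a.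
  by rewrite invmK // imf memJ_norm ?(subsetP nPS).
have conj1 : conj^~ 1 =1 id by move=> x; apply: fI; rewrite conjE morph1 conjg1.
have conjM x : act_morph conj x.
  by move=> a b; apply: fI; rewrite !conjE morphM ?inE // conjgM.
pose act := TotalAction conj1 conjM.
have actG : is_groupAction [set: rT] act.
  move=> a _; rewrite inE; apply/andP; split; first by apply/subsetP=> x; rewrite inE.
  apply/morphicP=> x y _ _; rewrite !actpermE; apply: fI.
  by rewrite [RHS]morphM ?inE // !conjE morphM ?inE // conjMg.
pose to := GroupAction actG; exists to.
have actf : {in [set: rT] & [set: aT], morph_act to 'J f g}.
  by move=> x a _ _; apply: conjE.
split.
  have -> : 'C([set: rT] | to) = g @*^-1 'C(P).
    apply/setP=> a; apply/astabP/morphpreP=> [fix_a | [_ /centP cPa] x _].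
      split; rewrite ?inE //; apply/centP=> y; rewrite -imf => /morphimP[x _ Rx ->].
      by apply/commute_sym/commgP/conjg_fixP; rewrite -conjE -[conj x a]/(to x a) fix_a.
    by apply: fI; rewrite conjE; apply/conjg_fixP/commgP/commute_sym/cPa.
  by rewrite -(card_injm injg) ?subsetT // -[_ @*^-1 _]setTI morphim_setIpre img.
rewrite isog_sym; apply/isogP; exists [morphism of xsdprodm actf].
  by rewrite injm_xsdprodm injf injg imf img tiPS eqxx.
by rewrite im_xsdprodm imf img.
Qed.

Lemma is_Cp_sdprod_Cqm_of_internal (gT : finGroupType)
    (G P S : {group gT}) (p q m : nat) :
  Cp_sdprod_Cqm_in G P S p q m -> is_Cp_sdprod_Cqm G.
Proof.
case=> pqm [defG oP cycS oS oC]; have [p_pr q_pr _ m_gt0] := pqm.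
have qm_gt1: 1 < q ^ m by rewrite -(exp1n m) ltn_exp2r ?prime_gt1.
have Zp_isog n (A : {group gT}) : 1 < n -> cyclic A -> #|A| = n ->
  [set: 'Z_n] \isog A.
  move=> n_gt1 cycA oA; rewrite isog_cyclic_card; last exact: cyclic_Zp.
  by rewrite cycA oA cardsT card_ord Zp_cast /=.
exists p, q, m; split=> //; rewrite -oC; apply: sdprod_isog_sdprod_by defG _ _.
  by apply: Zp_isog; rewrite ?prime_gt1 ?prime_cyclic ?oP.
exact: Zp_isog.
Qed.

(** * Minimal non-cyclic groups that are not of prime power order *)

(** Choosing P inside of [H, S] ensures that S does not centralise P: for a
    coprime action on an abelian group H, no nontrivial element of [H, S] is
    fixed by S.  Normality of P is free, as H is cyclic and normal. *)
Lemma nonpgroup_proper_cyclic (gT : finGroupType) (G : {group gT}) :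
    ~~ cyclic G -> proper_cyclic G -> (forall p : nat, ~~ p.-group G) ->
  exists p q m, exists P S : {group gT}, Cp_sdprod_Cqm_in G P S p q m.
Proof.
move=> ncG prG notpG.
have ntG: G :!=: 1 by apply: contraNneq ncG => ->; apply: cyclic1.
have ab (H : {group gT}) : H \proper G -> abelian H by move/prG/cyclic_abelian.
have [M maxM nsMG] := exists_normal_maximal ntG ab.
have [prM _] := maxgroupP maxM.
have /pdivP[q q_pr q_dv]: 1 < #|G : M| by rewrite indexg_gt1 proper_subn.
have [S sylS] := Sylow_exists q G.
have [sSG qS _] := and3P sylS.
have cycS: cyclic S.
  apply: prG; rewrite properEneq sSG andbT.
  by apply: contraNneq (notpG q) => <-.
have nSM: ~~ (S \subset M).
  apply: contraL q_dv => sSM; rewrite -p'natE //.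
  have [_ _] := and3P sylS; apply: pnat_dvd.
  exact: indexgS.
have defMS: M * S = G by apply: mulg_normal_maximal.
pose H := 'O_q^'(M)%G.
have sHM: H \subset M := pcore_sub _ _.
have nsHG: H <| G by apply: char_normal_trans nsMG; apply: pcore_char.
have cycM: cyclic M := prG M prM.
have cycH: cyclic H by apply: cyclicS sHM cycM.
have nHS: S \subset 'N(H) := subset_trans sSG (normal_norm nsHG).
have coHS: coprime #|H| #|S|.
  by rewrite coprime_sym (pnat_coprime qS) //; apply: pcore_pgroup.
(* If S centralised H, then G = HS would be cyclic, since the q-part of M
   lies in S. *)
have ntHS: [~: H, S] != 1.
  apply: contra ncG => /eqP/commG1P cHS.
  have /dprodP[_ defM _ _] := nilpotent_pcoreC q (abelian_nil (cyclic_abelian cycM)).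
  have sOS: 'O_q(M) \subset S.
    apply: subset_trans (pcore_sub_Hall sylS); apply: pcore_max; first exact: pcore_pgroup.
    by apply: char_normal_trans nsMG; apply: pcore_char.
  have -> : G :=: H * S.
    apply/eqP; rewrite eqEsubset mul_subG ?(normal_sub nsHG) // andbT -defMS -defM.
    rewrite (centC (subset_trans sOS _)); last by rewrite centsC.
    by rewrite -mulgA mulgS // mul_subG.
  by apply: cyclicM; rewrite // centsC.
have /pdivP[p p_pr pHS]: 1 < #|[~: H, S]| by rewrite cardG_gt1.
have [x HSx ox] := Cauchy p_pr pHS.
pose P := <[x]>%G.
have sPHS: P \subset [~: H, S] by rewrite cycle_subG.
have sPH: P \subset H by rewrite (subset_trans sPHS) // commg_subl.
have nsPG: P <| G by apply: char_normal_trans nsHG; rewrite sub_cyclic_char.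
have ncPS: ~~ (S \subset 'C(P)).
  apply/negP; rewrite centsC => cPS; have := prime_gt1 p_pr.
  have: P \subset 'C_[~: H, S](S) by rewrite subsetI sPHS.
  rewrite coprime_abel_cent_TI ?cyclic_abelian // => /trivgP P1.
  by rewrite -ox orderE -/(gval P) P1 cards1.
have coPS: coprime #|P| #|S| := coprimeSg sPH coHS.
have tiPS: P :&: S = 1 := coprime_TIg coPS.
have nPS: S \subset 'N(P) := subset_trans sSG (normal_norm nsPG).
have sPG: P \subset G := normal_sub nsPG.
have defG: P ><| S = G.
  rewrite sdprodE // -norm_joinEr //.
  have: P <*> S \subset G by rewrite join_subG sPG.
  rewrite subEproper => /predU1P[// | /(prG (P <*> S)%G)/cyclic_abelian cPS].
  case/negP: ncPS; apply: subset_trans (joing_subr P S) _.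
  by apply: subset_trans cPS _; rewrite centS ?joing_subl.
have ntS: S :!=: 1 by apply: contraNneq ncPS => ->; apply: sub1G.
have [_ q_dvS [m oS]] := pgroup_pdiv qS ntS.
have neq_pq : p != q.
  apply: contraL coPS => /eqP eq_pq.
  by rewrite -orderE ox eq_pq prime_coprime // negbK.
have [S1 | [T maxT _]] := maximal_exists (sub1G S); first by rewrite -S1 eqxx in ntS.
have [prT maxTS] := maxgroupP maxT; have sTS := proper_sub prT.
have oT: #|T| = (q ^ m)%N.
  have := Lagrange sTS; rewrite (p_maximal_index qS maxT) oS expnSr => /eqP.
  by rewrite eqn_pmul2r ?prime_gt0 // => /eqP.
have cTP: T \subset 'C(P).
  have nPT := subset_trans sTS nPS.
  have: P <*> T \proper G.
    rewrite properEcard join_subG sPG (subset_trans sTS sSG) /=.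
    rewrite norm_joinEr // TI_cardMg; last first.
      by apply/trivgP; rewrite -tiPS setIS.
    by rewrite -(sdprod_card defG) ltn_pmul2l // proper_card.
  move/(prG (P <*> T)%G)/cyclic_abelian => cPT.
  apply: subset_trans (joing_subr P T) _.
  by apply: subset_trans cPT _; rewrite centS ?joing_subl.
have defC: 'C_S(P) = T.
  apply: (maxTS 'C_S(P)%G); last by rewrite subsetI sTS.
  by rewrite properE subsetIl subsetI subxx.
exists p, q, m.+1, P, S; split=> //; split=> //.
by rewrite defC oT.
Qed.

(** * The classification *)

Theorem theorem1 (gT : finGroupType) (G : {group gT}) (dG : 'm(G) = 2) :
  rank_independent G <->
  [\/ exists2 p : nat, prime p & G \isog [set: 'Z_p * 'Z_p],
      G \isog 'Q_8
    | is_Cp_sdprod_Cqm G].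
Proof.
apply: (iff_trans (rank_independentP dG)); split=> [prG | ].
  have ncG := grank2_noncyclic dG.
  have [pG | notpG] := boolP ((pdiv #|G|).-group G).
    have [[p_pr isoG] | isoG] := pgroup_proper_cyclic pG ncG prG.
      by constructor 1; exists (pdiv #|G|).
    by constructor 2.
  constructor 3.
  have [|p [q [m [P [S dataG]]]]] := nonpgroup_proper_cyclic ncG prG.
    move=> p; apply: contra notpG => pG.
    have ntG: G :!=: 1 by apply: contraNneq ncG => ->; apply: cyclic1.
    have [p_pr _ [k oG]] := pgroup_pdiv pG ntG.
    by rewrite oG pdiv_pfactor.
  exact: is_Cp_sdprod_Cqm_of_internal dataG.
case=> [[p p_pr isoG] | | [p [q [m [pqm [to [oC isoG]]]]]]].
- apply: (prime_square_proper_cyclic p_pr).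
  by have [_ <-] := ZpZp_abelem p_pr; apply: card_isog.
- exact: Q8_proper_cyclic.
apply: isog_proper_cyclic isoG _.
exact: Cp_sdprod_Cqm_proper_cyclic (sdprod_by_Cp_sdprod_Cqm_in pqm oC).
Qed.
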